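(* Let $K$ be a field, let $X$ be a set of non-commuting variables and let $K\langle X\rangle$ be the free associative $K$-algebra on $X$. Let $f\in K\langle X\rangle\setminus K$. Then the centralizer $C(f;K\langle X\rangle)=\{g\in K\langle X\rangle : gf=fg\}$ is isomorphic as a $K$-algebra to a polynomial algebra $K[z]$ in a single variable over $K$.
   Context: Elements of $K\langle X\rangle$ lying in $K$ are called constant (or scalar) elements. For a $K$-algebra $A$ and $a\in A$, the centralizer $C(a;A)$ is the subalgebra of all elements of $A$ commuting with $a$. *)

(* Defs.v *)
From HB Require Import structures.
From mathcomp Require Import all_boot all_algebra.
From mathcomp Require Import finmap monalg.

Set Implicit Arguments.
Unset Strict Implicit.
Unset Printing Implicit Defensive.

Import GRing.Theory.
Local Open Scope ring_scope.

Lemma malg_scalerAr (K : comNzRingType) (M : monomType) (c : K)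
    (g h : {malg K[M]}) : c *: (g * h) = g * (c *: h).
Proof.
apply/malgP => k; rewrite mcoeffZ mcoeffMl.
rewrite (mcoeffMlw _ (fsubset_refl _) (msuppZ_le c h)) mulr_sumr.
apply: eq_bigr => k1 _; rewrite mulr_sumr; apply: eq_bigr => k2 _.
by rewrite mcoeffZ mulrnAr mulrCA.
Qed.

(* The free associative algebra on X is the algebra of the free monoid
   {fmonom X} (words in X under concatenation). It is an alias because
   {malg K[M]} is canonically an algType only for commutative M. *)
Definition free_alg (K : comNzRingType) (X : choiceType) : Type :=
  {malg K[{fmonom X}]}.

Section FreeAlgebra.
Variables (K : comNzRingType) (X : choiceType).

HB.instance Definition _ := GRing.Lalgebra.on (free_alg K X).
HB.instance Definition _ :=
  GRing.Lalgebra_isAlgebra.Build K (free_alg K X)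
    (@malg_scalerAr K {fmonom X}).

End FreeAlgebra.

Section Centralizer.
Variables (K : comNzRingType) (A : algType K) (a : A).

Definition centralizer_pred : {pred A} := [pred g : A | g * a == a * g].

Lemma centralizerP (g : A) :
  reflect (g * a = a * g) (g \in centralizer_pred).
Proof. exact: eqP. Qed.

Lemma centralizer_subalg_closed : GRing.subsemialg_closed centralizer_pred.
Proof.
split; first by apply/centralizerP; rewrite mul1r mulr1.
- split; first by apply/centralizerP; rewrite mul0r mulr0.
  move=> g h /centralizerP ga /centralizerP ha; apply/centralizerP.
  by rewrite mulrDl mulrDr ga ha.
- move=> c g /centralizerP ga; apply/centralizerP.
  by rewrite -scalerAl -scalerAr ga.
- move=> g h /centralizerP ga /centralizerP ha; apply/centralizerP.
  by rewrite -mulrA ha !mulrA ga.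
Qed.

(* C(a; A) as a type, carrying the K-algebra structure inherited from A. *)
Record centralizer : predArgType := Centralizer {
  centralizer_val :> A;
  centralizer_valP : centralizer_val \in centralizer_pred
}.

HB.instance Definition _ := [isSub for centralizer_val].
HB.instance Definition _ := [Choice of centralizer by <:].
HB.instance Definition _ :=
  GRing.SubChoice_isSubAlgebra.Build K A centralizer_pred centralizer
    centralizer_subalg_closed.

End Centralizer.

Definition alg_isomorphic (K : comNzRingType) (A B : algType K) : Prop :=
  exists phi : {lrmorphism A -> B}, bijective phi.

(* Main.v *)
Require Import Defs.
From HB Require Import structures.
From mathcomp Require Import all_boot all_order all_algebra.
From mathcomp Require Import finmap monalg ring zify.
From Stdlib Require Import Classical.

Set Implicit Arguments.
Unset Strict Implicit.
Unset Printing Implicit Defensive.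

Import Order.TTheory GRing.Theory Num.Theory.
Local Open Scope ring_scope.

(** This is Bergman's centralizer theorem. Write R for the free algebra and C
    for the centralizer of the non-scalar element f. The proof finds z in C with
    C = K + z C; an induction on degrees then gives C = K[z].

    A point of the affine line. The algebra C embeds in K[t]. Number the letters
    and read words as numerals in some base b; the slope of a nonempty word u is
    the rational number val u / (b ^ |u| - 1), that is, the periodic expansion
    u u u ... up to normalization. The slope of u v is a weighted mean of the
    slopes of u and v, so the words whose slope is at most r span a subalgebra,
    and keeping only those of slope exactly r, with u sent to t ^ |u|, is a
    homomorphism on it. Comparing extremal words in f g = g f shows that all
    non-scalar elements of C have the same maximal slope
    ([comm_defect_le0], [comm_defect_eq0]); with r that slope one gets an
    injective homomorphism phi : C -> K[t] ([centralizer_embedding]). In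
    particular C is commutative.

    A moving factor. Put s = phi f, let F = f - s(t) in R[t], and let J be the
    kernel of the homomorphism C[t] -> K[t] that extends phi and fixes t. Over
    the field K(t) the weak algorithm makes the right ideal generated by two
    commuting elements principal ([weak_algorithm]), and Gauss's lemma clears
    denominators, so commuting a and b in R[t] have a common left divisor d with
    r d in a R[t] + b R[t] for some nonzero r in K[t] ([saturated_gcld]).
    The decisive point is [divisor_commutes]: if d divides F on the left
    and f d = d f', then comparing degrees in t shows that f' does not involve
    t; the leading coefficient of d in t divides that of F, which is a scalar,
    and so f' = f. Hence such a d lies in C[t]. It
    follows that J is principal ([spec_kernel]): a generator is an element d of J
    that divides F and has minimal degree in t, provided that elements of J never
    generate a right ideal of R[t] meeting K[t] nontrivially, which is [no_bezout].

    Specialization. For c in C the element c - (phi c)(t) lies in J = d C[t];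
    at t = 0 this reads c - (phi c)(0) = z y with z = d(0), y in C
    ([cent_generator]). *)

(** * Algebras with coefficients on words *)

Lemma seq_argmax (T : eqType) (d : Order.disp_t) (O : orderType d)
    (key : T -> O) (s : seq T) (x0 : T) :
  x0 \in s -> exists2 x, x \in s & {in s, forall y, (key y <= key x)%O}.
Proof.
elim: s x0 => // x s IHs x0 _; case: s IHs => [_|y s /(_ y (mem_head _ _))].
  by exists x; rewrite ?mem_head // => y; rewrite inE => /eqP->.
case=> z z_s z_max; have [le_xz|lt_zx] := leP (key x) (key z).
  exists z; first by rewrite in_cons z_s orbT.
  by move=> t /predU1P[->|/z_max].
exists x; first exact: mem_head.
move=> t /predU1P[->//|/z_max le_tz].
exact: le_trans le_tz (ltW lt_zx).
Qed.

(** All that the proof uses of the free algebra: the coefficient of an element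
    on a word, a finite list of words containing the support, and the transpose
    of right multiplication by a word. Stating the results for an abstract R also
    keeps type checking away from the construction of the monoid algebra. *)
Record word_basis (K : fieldType) (X : choiceType) (R : algType K) := WordBasis {
  wcoef : seq X -> R -> K;
  wsupp : R -> seq (seq X);
  wshift : seq X -> R -> R;
  wcoefB : forall w, zmod_morphism (wcoef w);
  wcoefZ : forall w c g, wcoef w (c *: g) = c * wcoef w g;
  wcoef1 : forall w, wcoef w 1 = (w == [::])%:R;
  wsupp_uniq : forall g, uniq (wsupp g);
  wcoefM_supp : forall w g h, wcoef w (g * h) =
    \sum_(u <- wsupp g) \sum_(v <- wsupp h)
      (wcoef u g * wcoef v h) *+ (u ++ v == w);
  wcoef_out : forall w g, w \notin wsupp g -> wcoef w g = 0;
  wcoefP : forall g, (forall w, wcoef w g = 0) -> g = 0;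
  wcoef_shift : forall b w g, wcoef w (wshift b g) = wcoef (w ++ b) g
}.

HB.instance Definition _ K X R (B : @word_basis K X R) w :=
  GRing.isZmodMorphism.Build R K (wcoef B w) (@wcoefB K X R B w).

Arguments wcoefP {K X R} B g : rename.
Arguments wcoef_out {K X R} B w g : rename.
Arguments wcoefM_supp {K X R} B w g h : rename.
Arguments wsupp_uniq {K X R} B g : rename.
Arguments wcoefZ {K X R} B w c g : rename.

Section WordBasis.
Variables (K : fieldType) (X : choiceType) (R : algType K).
Variable B : word_basis X R.
Local Notation wcoef := (wcoef B).
Local Notation wsupp := (wsupp B).
Implicit Types (g h : R) (u v w : seq X).

(** The product formula by cutting w in two; unlike [wcoefM_supp] its index
    set does not depend on g and h. *)
Lemma wcoefM w g h :
  wcoef w (g * h) =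
    \sum_(i < (size w).+1) wcoef (take i w) g * wcoef (drop i w) h.
Proof.
have wsum u (x : R) : wcoef u x = \sum_(k <- wsupp x) wcoef k x *+ (k == u).
  have [u_in|u_out] := boolP (u \in wsupp x).
    rewrite (bigD1_seq u) ?wsupp_uniq //= eqxx big1 ?addr0 // => k ne_k.
    by rewrite (negPf ne_k).
  rewrite wcoef_out // big1_seq // => k /= k_in; case: eqP => // eq_k.
  by rewrite -eq_k k_in in u_out.
rewrite wcoefM_supp.
under [RHS]eq_bigr => i _ do rewrite !(wsum (_ _ w)) big_distrlr /=.
rewrite [RHS]exchange_big; apply: eq_bigr => k1 _ /=.
rewrite [RHS]exchange_big; apply: eq_bigr => k2 _ /=.
under eq_bigr => i _ do rewrite mulrnAl mulrnAr -mulrnA mulnb.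
have [<-|ne] := eqVneq (k1 ++ k2) w.
  have lt_k1 : (size k1 < (size (k1 ++ k2)).+1)%N by rewrite ltnS size_cat leq_addr.
  rewrite (bigD1 (Ordinal lt_k1)) //= take_size_cat // drop_size_cat // !eqxx.
  rewrite big1 ?addr0 // => i ne_i; case: andP => // -[_ /eqP def_k1].
  rewrite -val_eqE /= in ne_i; case/eqP: ne_i; rewrite [in RHS]def_k1 size_take.
  by have:= ltn_ord i; rewrite ltnS leq_eqVlt => /predU1P[->|->]; rewrite ?ltnn.
rewrite big1 // => i _; case: andP => // -[/eqP e2 /eqP e1].
by rewrite e1 e2 cat_take_drop eqxx in ne.
Qed.

Lemma wcoefA w c : wcoef w c%:A = c *+ (w == [::]).
Proof. by rewrite wcoefZ wcoef1 mulr_natr. Qed.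

Lemma wcoef_supp w g : wcoef w g != 0 -> w \in wsupp g.
Proof. by apply: contraR => /wcoef_out->. Qed.

Section LinearExtension.
Variables (S : algType K) (h : seq X -> S).

(** The linear map sending each word w to h w. *)
Definition wext g : S := \sum_(w <- wsupp g) wcoef w g *: h w.

Lemma wextE (T : seq (seq X)) g :
    uniq T -> (forall w, wcoef w g != 0 -> w \in T) ->
  wext g = \sum_(w <- T) wcoef w g *: h w.
Proof.
move=> uT gT; have nz_sum (Z : seq (seq X)) :
    \sum_(w <- Z) wcoef w g *: h w =
    \sum_(w <- [seq w <- Z | wcoef w g != 0]) wcoef w g *: h w.
  rewrite big_filter (bigID (fun w => wcoef w g != 0)) /=.
  by rewrite [X in _ + X]big1 ?addr0 // => w /negPn/eqP->; rewrite scale0r.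
rewrite /wext nz_sum [RHS]nz_sum; apply: perm_big; apply: uniq_perm.
- by rewrite filter_uniq ?wsupp_uniq.
- by rewrite filter_uniq.
move=> w; rewrite !mem_filter; have [//|nz_w] /= := eqVneq (wcoef w g) 0.
by rewrite gT // wcoef_supp.
Qed.

Lemma wextB : zmod_morphism wext.
Proof.
move=> g1 g2; pose T := undup (wsupp g1 ++ wsupp g2).
have inT g : {subset wsupp g <= T} -> forall w, wcoef w g != 0 -> w \in T.
  by move=> sub w /wcoef_supp/sub.
have sT1 : {subset wsupp g1 <= T} by move=> w w1; rewrite mem_undup mem_cat w1.
have sT2 : {subset wsupp g2 <= T} by move=> w w2; rewrite mem_undup mem_cat w2 orbT.
have uT := undup_uniq (wsupp g1 ++ wsupp g2).
rewrite (wextE uT (inT _ sT1)) (wextE uT (inT _ sT2)) -sumrB (wextE uT).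
  by apply: eq_bigr => w _; rewrite raddfB scalerBl.
move=> w; rewrite raddfB /=; apply: contraR => w_out.
rewrite !(wcoef_out B) ?subrr //; first exact: contra (@sT2 w) w_out.
exact: contra (@sT1 w) w_out.
Qed.

Lemma wextZ c g : wext (c *: g) = c *: wext g.
Proof.
rewrite (wextE (wsupp_uniq B g)) => [|w].
  by rewrite scaler_sumr; apply: eq_bigr => w _; rewrite wcoefZ scalerA.
by rewrite wcoefZ mulf_eq0 negb_or => /andP[_ /wcoef_supp].
Qed.

(** Multiplicativity of h is asked on the words of g1 and g2 alone, since the
    function h of the embedding into K[t] is multiplicative only on words of
    bounded slope. *)
Lemma wextM g1 g2 :
    (forall u v, wcoef u g1 != 0 -> wcoef v g2 != 0 -> h (u ++ v) = h u * h v) ->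
  wext (g1 * g2) = wext g1 * wext g2.
Proof.
move=> hM; pose T := undup (wsupp (g1 * g2) ++ [seq u ++ v | u <- wsupp g1, v <- wsupp g2]).
rewrite (wextE (undup_uniq _ : uniq T)) => [|w /wcoef_supp w_in]; last first.
  by rewrite mem_undup mem_cat w_in.
under eq_bigr => w _ do rewrite wcoefM_supp scaler_suml.
rewrite exchange_big mulr_suml; apply: eq_big_seq => u u_in /=.
under eq_bigr => w _ do rewrite scaler_suml.
rewrite exchange_big mulr_sumr; apply: eq_big_seq => v v_in /=.
have uv_in : u ++ v \in T by rewrite mem_undup mem_cat allpairs_f ?orbT.
rewrite (bigD1_seq (u ++ v)) ?undup_uniq //= eqxx big1 ?addr0 => [|w ne_w]; last first.
  by rewrite eq_sym (negPf ne_w) scale0r.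
have [->|nz_u] := eqVneq (wcoef u g1) 0; first by rewrite !(mul0r, scale0r).
have [->|nz_v] := eqVneq (wcoef v g2) 0; first by rewrite !(mulr0, scale0r).
by rewrite hM // -scalerAl -scalerAr scalerA.
Qed.

End LinearExtension.

End WordBasis.

(** * Longest words and Gauss's lemma *)

Section Gauss.
Variables (K : fieldType) (X : choiceType) (R : algType K).
Variable B : word_basis X R.
Local Notation wcoef := (wcoef B).
Local Notation wsupp := (wsupp B).
Implicit Types (a b d : {poly R}) (s p q : {poly K}) (u v w : seq X).

(** R[t] read as K[t]<X>: the coefficient of a on the word w, an element of
    K[t]. *)
Definition tcoef w a : {poly K} := map_poly (wcoef w) a.

Lemma coef_tcoef w a i : (tcoef w a)`_i = wcoef w a`_i.
Proof. exact: coef_map. Qed.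

Fact tcoef_is_zmod_morphism w : zmod_morphism (tcoef w).
Proof. by move=> a b; apply: raddfB. Qed.
HB.instance Definition _ w :=
  GRing.isZmodMorphism.Build {poly R} {poly K} (tcoef w)
    (tcoef_is_zmod_morphism w).

Lemma tcoefP a : (forall w, tcoef w a = 0) -> a = 0.
Proof.
move=> a0; apply/polyP => i; rewrite coef0; apply: (wcoefP B) => w.
by rewrite -coef_tcoef a0 coef0.
Qed.

Lemma tcoefM w a b :
  tcoef w (a * b) =
    \sum_(i < (size w).+1) tcoef (take i w) a * tcoef (drop i w) b.
Proof.
apply/polyP => n; rewrite coef_tcoef coefM coef_sum raddf_sum /=.
under eq_bigr => j _ do rewrite wcoefM.
under [RHS]eq_bigr => j _ do rewrite coefM.
rewrite exchange_big /=; apply: eq_bigr => i _; apply: eq_bigr => j _.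
by rewrite !coef_tcoef.
Qed.

Lemma tcoefC w (g : R) : tcoef w g%:P = (wcoef w g)%:P.
Proof. exact: map_polyC. Qed.

Definition twords a : seq (seq X) :=
  flatten [seq wsupp a`_i | i <- iota 0 (size a)].

Lemma tcoef_out w a : w \notin twords a -> tcoef w a = 0.
Proof.
move=> w_out; apply/polyP => i; rewrite coef0 coef_tcoef.
have [le_a_i|lt_i_a] := leqP (size a) i; first by rewrite nth_default ?raddf0.
apply: (wcoef_out B); apply: contra w_out => w_in; apply/flatten_mapP.
by exists i; rewrite ?mem_iota.
Qed.

(** For s = 0 divisibility by s means vanishing, so this and the next lemma
    treat leading words and leading words modulo s at once. *)
Lemma longest_word s a w :
  ~~ (s %| tcoef w a) -> exists2 u, ~~ (s %| tcoef u a) &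
    forall v, (size u < size v)%N -> s %| tcoef v a.
Proof.
move=> ndv_w; pose S := [seq v <- twords a | ~~ (s %| tcoef v a)].
have inS v : ~~ (s %| tcoef v a) -> v \in S.
  move=> ndv; rewrite mem_filter ndv; apply: contraR ndv => /tcoef_out->.
  exact: dvdp0.
have [u] := seq_argmax size (inS _ ndv_w); rewrite mem_filter => /andP[ndv_u _] max_u.
exists u => // v; rewrite ltnNge; apply: contraR => /inS/max_u.
by rewrite leEnat.
Qed.

(** In any other cut of u ++ v one of the two pieces is longer than u or than v. *)
Lemma tcoefM_longest s u v a b :
    (forall w, (size u < size w)%N -> s %| tcoef w a) ->
    (forall w, (size v < size w)%N -> s %| tcoef w b) ->
  s %| tcoef (u ++ v) (a * b) - tcoef u a * tcoef v b.
Proof.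
move=> ua vb; have lt_u : (size u < (size (u ++ v)).+1)%N.
  by rewrite ltnS size_cat leq_addr.
rewrite tcoefM (bigD1 (Ordinal lt_u)) //= take_size_cat // drop_size_cat //.
rewrite addrC addrK; elim/big_ind: _ => [|x y|i ne_i]; first exact: dvdp0.
  by move=> sx sy; rewrite dvdp_addl.
have le_i : (i <= size (u ++ v))%N by rewrite -ltnS.
have [lt_ui|] := ltnP (size u) i.
  by rewrite dvdp_mulr // ua // size_takel.
rewrite leq_eqVlt => /predU1P[eq_i|lt_iu]; first by case/eqP: ne_i; apply: val_inj.
rewrite dvdp_mull // vb // size_drop ltn_subRL.
by move: lt_iu; rewrite -(ltn_add2r (size v)) -size_cat.
Qed.

Lemma dvd_tcoefVN s a :
  (forall w, s %| tcoef w a) \/ (exists w, ~~ (s %| tcoef w a)).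
Proof.
have [/allP dv|/allPn[w _ ndv]] := boolP (all (fun w => s %| tcoef w a) (twords a)).
  left=> w; have [/dv//|/tcoef_out->] := boolP (w \in twords a); exact: dvdp0.
by right; exists w.
Qed.

(** Modulo s the coefficient of a b on the product of a longest word of a and a
    longest word of b is the product of the two coefficients. *)
Lemma gauss_prime s a b : irreducible_poly s ->
    (forall w, s %| tcoef w (a * b)) ->
  (forall w, s %| tcoef w a) \/ (forall w, s %| tcoef w b).
Proof.
move=> irr_s dv_ab; have [|[w /longest_word[u ndv_u max_u]]] := dvd_tcoefVN s a.
  by left.
right=> w'; apply/idPn => /longest_word[v ndv_v max_v].
have := tcoefM_longest max_u max_v; rewrite dvdp_addr // dvdpNr => dv_uv.
have cop x : ~~ (s %| x) -> coprimep s x.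
  move=> ndv_x; rewrite /coprimep; apply: contraR ndv_x => /irr_s/(_ (dvdp_gcdl _ _)).
  by move/eqp_dvdl <-; rewrite dvdp_gcdr.
by rewrite (Gauss_dvdpr _ (cop _ ndv_u)) (negPf ndv_v) in dv_uv.
Qed.

Lemma longest_word0 a : a != 0 -> exists2 u, tcoef u a != 0 &
  forall v, (size u < size v)%N -> tcoef v a = 0.
Proof.
move=> nz_a.
have [a0|[w nz_w]] := dvd_tcoefVN 0 a.
  by case/eqP: nz_a; apply: tcoefP => w; have := a0 w; rewrite dvd0p => /eqP.
have [u nz_u max_u] := longest_word nz_w; exists u; rewrite -?dvd0p // => v.
by move/max_u; rewrite dvd0p => /eqP.
Qed.

Lemma tcoefM_longest0 u v a b :
    (forall w, (size u < size w)%N -> tcoef w a = 0) ->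
    (forall w, (size v < size w)%N -> tcoef w b = 0) ->
  tcoef (u ++ v) (a * b) = tcoef u a * tcoef v b.
Proof.
move=> ua vb; apply/eqP; rewrite -subr_eq0 -dvd0p; apply: tcoefM_longest => w lt_w.
  by rewrite ua.
by rewrite vb.
Qed.

Lemma tpoly_mulf_eq0 a b : (a * b == 0) = (a == 0) || (b == 0).
Proof.
have [->|nz_a] := eqVneq a 0; first by rewrite mul0r eqxx.
have [->|nz_b] := eqVneq b 0; first by rewrite mulr0 eqxx.
have [u nz_u max_u] := longest_word0 nz_a; have [v nz_v max_v] := longest_word0 nz_b.
apply/eqP => ab0; have := tcoefM_longest0 max_u max_v.
by rewrite ab0 raddf0 => /esym/eqP; rewrite mulf_eq0 (negPf nz_u) (negPf nz_v).
Qed.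

Lemma tpoly_mulfI a b b' : a != 0 -> a * b = a * b' -> b = b'.
Proof.
move=> nz_a /eqP; rewrite -subr_eq0 -mulrBr tpoly_mulf_eq0 (negPf nz_a) /=.
by rewrite subr_eq0 => /eqP.
Qed.

Lemma word_mulf_eq0 (g h : R) : (g * h == 0) = (g == 0) || (h == 0).
Proof. by rewrite -!(polyC_eq0 (_ : R)) polyCM tpoly_mulf_eq0. Qed.

End Gauss.

(** * The weak algorithm without denominators *)

Section WeakAlgorithm.
Variables (K : fieldType) (X : choiceType) (R : algType K).
Variable B : word_basis X R.
Local Notation wcoef := (wcoef B).
Local Notation wshift := (wshift B).
Local Notation tcoef := (tcoef B).
Implicit Types (a b d : {poly R}) (s p q : {poly K}) (u v w : seq X).

Definition tscal s : {poly R} := map_poly (in_alg R) s.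
HB.instance Definition _ := GRing.RMorphism.copy tscal (map_poly (in_alg R)).

Lemma tscalC s a : tscal s * a = a * tscal s.
Proof.
apply/polyP => n; rewrite coefM coefMr; apply: eq_bigr => i _.
by rewrite !coef_map /= -scalerAl mul1r -scalerAr mulr1.
Qed.

Lemma tcoefZ w s a : tcoef w (tscal s * a) = s * tcoef w a.
Proof.
apply/polyP => n; rewrite coef_tcoef !coefM raddf_sum; apply: eq_bigr => i _.
by rewrite coef_map /= -scalerAl mul1r wcoefZ coef_tcoef.
Qed.

Lemma tscal_eq0 s : (tscal s == 0) = (s == 0).
Proof. exact: map_poly_eq0. Qed.

Definition tshift (c : seq X) (y : {poly R}) : {poly R} := map_poly (wshift c) y.

Lemma tcoef_shift w c (v : {poly R}) :
  tcoef w (tshift c v) = tcoef (w ++ c) v.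
Proof.
have shift0 : wshift c (0 : R) = 0.
  by apply: (wcoefP B) => w'; rewrite wcoef_shift raddf0.
by apply/polyP => i; rewrite !coef_tcoef coef_map_id0 // wcoef_shift.
Qed.

(** If b has no word longer than w, the cuts of w ++ c that contribute to b v
    all leave the suffix c in the right factor. *)
Lemma tcoefM_shift w c b (v : {poly R}) :
    (forall w', (size w < size w')%N -> tcoef w' b = 0) ->
  tcoef (w ++ c) (b * v) = tcoef w (b * tshift c v).
Proof.
move=> b0; rewrite !tcoefM.
rewrite -(big_mkord xpredT (fun i => tcoef (take i (w ++ c)) b * tcoef (drop i (w ++ c)) v)).
rewrite -(big_mkord xpredT (fun i => tcoef (take i w) b * tcoef (drop i w) _)).
rewrite (big_cat_nat (n := (size w).+1)) //=; last first.
  by rewrite ltnS size_cat leq_addr.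
rewrite [X in _ + X]big_nat [X in _ + X]big1 => [|i /andP[lt_wi lt_i]]; last first.
  by rewrite b0 ?mul0r // size_takel.
rewrite addr0.
rewrite !big_nat; apply: eq_bigr => i /andP[_]; rewrite ltnS => le_iw.
rewrite tcoef_shift takel_cat // drop_cat; case: ltnP => // le_wi.
have /eqP-> : i == size w by rewrite eqn_leq le_iw.
by rewrite subnn drop0 drop_size.
Qed.

Definition tdeg_le n a := forall w, (n < size w)%N -> tcoef w a = 0.

(** The division step. Let c be a longest word of x and let w be at least as long
    as the longest words of a. On w ++ c, the coefficient of a x is that of a
    on w times that of x on c, while the coefficient of b y is that of b y' on w,
    where y' collects the coefficients of y on words ending in c. So y' divided
    by the coefficient of x on c is a quotient of a by b. *)
Lemma weak_step m l a b (x y : {poly R}) c : (l <= m)%N ->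
    tdeg_le m a -> tdeg_le l b -> tdeg_le (size c) x -> a * x = b * y ->
  forall w, (m <= size w)%N ->
    tcoef w (tscal (tcoef c x) * a - b * tshift c y) = 0.
Proof.
move=> le_lm da db dx def_ax w le_mw.
have [da' db'] : tdeg_le (size w) a /\ tdeg_le (size w) b.
  split=> w' lt_ww'; [apply: da | apply: db].
    exact: leq_ltn_trans lt_ww'.
  exact: leq_ltn_trans (leq_trans le_lm le_mw) lt_ww'.
rewrite raddfB /= tcoefZ -tcoefM_shift // -def_ax tcoefM_longest0 //.
by rewrite mulrC subrr.
Qed.

(** Over K(t) this says that d is a greatest common left divisor of a and b with
    a Bezout relation; s and s' are the denominators. *)
Definition gen_gcld a b := exists d a' b' x y s s',
  [/\ s != 0, s' != 0, tscal s * a = d * a', tscal s * b = d * b' &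
      tscal s' * d = a * x + b * y].

Lemma gen_gcldC a b : gen_gcld a b -> gen_gcld b a.
Proof.
case=> d [a' [b' [x [y [s [s' [nz_s nz_s' da db dd]]]]]]].
by exists d, b', a', y, x, s, s'; split; rewrite // addrC.
Qed.

(** The Euclidean algorithm driven by [weak_step]. It never gets stuck, since the
    relation a x = b y with x nonzero passes to the remainder and b. *)
Lemma weak_algorithm a b (x y : {poly R}) :
  a != 0 -> b != 0 -> x != 0 -> a * x = b * y -> gen_gcld a b.
Proof.
move=> nz_a nz_b nz_x def_ax.
have exdeg c : c != 0 -> exists n, tdeg_le n c.
  by move=> nz_c; have [u _ du] := longest_word0 B nz_c; exists (size u).
have [[m da] [l db]] := (exdeg a nz_a, exdeg b nz_b).
have [n] := ubnP (m + l); elim: n m l a b x y nz_a nz_b nz_x def_ax da db => // n IHn.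
move=> m l a b x y; wlog le_lm : m l a b x y / (l <= m)%N.
  move=> IH nz_a nz_b nz_x def_ax da db lt_n.
  have [le_lm|/ltnW le_ml] := leqP l m; first exact: (IH m l a b x y).
  apply/gen_gcldC; apply: (IH l m b a y x); rewrite 1?addnC //.
  by apply: contraNneq nz_x => y0; move/eqP: def_ax; rewrite y0 mulr0 (tpoly_mulf_eq0 B) (negPf nz_a).
move=> nz_a nz_b nz_x def_ax da db lt_n.
have [c nz_c max_c] := longest_word0 B nz_x.
set e := tcoef c x in nz_c *; set q := tshift c y.
have := weak_step le_lm da db max_c def_ax; rewrite -/e -/q.
set a1 : {poly R} := tscal e * a - b * q => da1.
have [a1_0|nz_a1] := eqVneq a1 0.
  exists b, q, (tscal e), 0, 1, e, 1; split; rewrite ?oner_eq0 //.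
  - by apply/eqP; rewrite -subr_eq0 -/a1 a1_0.
  - by rewrite tscalC.
  by rewrite rmorph1 mulr0 add0r mul1r mulr1.
case: m da1 le_lm da lt_n => [|m] da1 le_lm da lt_n.
  by case/eqP: nz_a1; apply: tcoefP => w; apply: da1.
have def_a1x : a1 * x = b * (tscal e * y - q * x).
  by rewrite /a1 mulrBl mulrBr -mulrA def_ax !mulrA [tscal e * b]tscalC.
have [|d [a' [b' [p' [q' [s [s' [nz_s nz_s' da1' db' dd]]]]]]]] :=
  IHn m l a1 b x _ nz_a1 nz_b nz_x def_a1x da1 db; first by rewrite -ltnS.
exists d, (a' + b' * q), (b' * tscal e), (tscal e * p'), (q' - q * p'), (s * e), s'.
split; rewrite ?mulf_neq0 //.
- rewrite rmorphM /= -mulrA -(subrK (b * q) (tscal e * a)) -/a1 mulrDr da1'.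
  by rewrite mulrA db' mulrDr mulrA.
- by rewrite rmorphM /= -mulrA [tscal e * b]tscalC mulrA db' mulrA.
by rewrite dd mulrBl mulrBr !mulrA -[a * tscal e]tscalC addrAC -addrA.
Qed.

End WeakAlgorithm.

(** * Content, and greatest common left divisors in R[t] *)

Section Saturation.
Variables (K : fieldType) (X : choiceType) (R : algType K).
Variable B : word_basis X R.
Local Notation tcoef := (tcoef B).
Local Notation tscal := (tscal R).
Implicit Types (a b d : {poly R}) (s p q : {poly K}).

Lemma wpoly_size_mul a b :
  a != 0 -> b != 0 -> size (a * b) = (size a + size b).-1.
Proof.
move=> nz_a nz_b; apply: size_proper_mul.
by rewrite (word_mulf_eq0 B) !lead_coef_eq0 negb_or nz_a.
Qed.

Lemma wpoly_lead_coefM a b : lead_coef (a * b) = lead_coef a * lead_coef b.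
Proof.
have [->|nz_a] := eqVneq a 0; first by rewrite lead_coef0 !mul0r lead_coef0.
have [->|nz_b] := eqVneq b 0; first by rewrite lead_coef0 !mulr0 lead_coef0.
apply: lead_coef_proper_mul.
by rewrite (word_mulf_eq0 B) !lead_coef_eq0 negb_or nz_a.
Qed.

Lemma size_tscal s : size (tscal s) = size s.
Proof. exact: size_map_poly. Qed.

(** The quotient is obtained by dividing in R[t] by s made monic; the remainder
    vanishes because its coefficients on words are divisible by s and have
    smaller degree. *)
Lemma tscal_dvd s a :
  s != 0 -> (forall w, s %| tcoef w a) -> exists b, a = tscal s * b.
Proof.
move=> nz_s dv_s; set c := lead_coef s.
have nz_c : c != 0 by rewrite lead_coef_eq0.
pose t := c^-1 *: s; have def_s : s = c *: t by rewrite scalerA mulfV ?scale1r.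
have mon_t : tscal t \is monic.
  by rewrite map_monic monicE lead_coefZ mulVf.
have def_a := Pdiv.RingMonic.rdivp_eq mon_t a.
set q := Pdiv.CommonRing.rdivp _ _ in def_a; set r := Pdiv.CommonRing.rmodp _ _ in def_a.
have r0 : r = 0.
  apply: (tcoefP (B := B)) => w; apply/eqP; apply: contraTT (dv_s w) => nz_r.
  rewrite def_a raddfD /= -tscalC tcoefZ dvdp_addr; last first.
    by rewrite dvdp_mulr // def_s dvdpZl.
  apply: contraL nz_r => /dvdp_leq; rewrite negbK.
  have [->//|nz_r /(_ isT)] := eqVneq (tcoef w r) 0; rewrite leqNgt.
  have lt_r : (size r < size t)%N.
    by rewrite -size_tscal Pdiv.CommonRing.ltn_rmodp monic_neq0.
  case/negP; rewrite [in X in (_ < X)%N]def_s size_scale //.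
  exact: leq_ltn_trans (size_poly _ _) lt_r.
exists (tscal (c^-1)%:P * q); rewrite mulrA -rmorphM /= mulrC mul_polyC -/t.
by rewrite tscalC {1}def_a r0 addr0.
Qed.

(** Divisibility by d on the left over K(t) already holds over K[t]. *)
Definition saturated d :=
  forall s (x y : {poly R}), s != 0 -> tscal s * x = d * y -> exists z, x = d * z.

Definition primitive d :=
  forall s, irreducible_poly s -> exists w, ~~ (s %| tcoef w d).

Lemma exists_irreducible s :
  (1 < size s)%N -> exists2 p, irreducible_poly p & p %| s.
Proof.
have [n] := ubnP (size s); elim: n s => // n IHn s lt_n s_gt1.
have [[q [q_neq1 dv_q ne_q]]|irr_s] :=
    classic (exists q, [/\ size q != 1%N, q %| s & ~~ (q %= s)]).
  have nz_s : s != 0 by rewrite -size_poly_gt0 ltnW.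
  have lt_q : (size q < size s)%N.
    by rewrite ltn_neqAle dvdp_leq // (dvdp_size_eqp dv_q) ne_q.
  have q_gt1 : (1 < size q)%N.
    by rewrite ltn_neqAle eq_sym q_neq1 size_poly_gt0 (dvdpN0 dv_q).
  have [|p irr_p dv_p] := IHn q _ q_gt1; first exact: leq_trans lt_q _.
  by exists p => //; apply: dvdp_trans dv_p dv_q.
exists s => //; split=> // q q_neq1 dv_q; apply/negPn/negP => ne_q.
by case: irr_s; exists q.
Qed.

(** The irreducible factors of s are cancelled one after the other: each
    divides d y, hence y by [gauss_prime]. *)
Lemma primitive_saturated d : primitive d -> saturated d.
Proof.
move=> prim_d s; have [n] := ubnP (size s); elim: n s => // n IHn s lt_n x y nz_s def_sx.
have [s_le1|/exists_irreducible[p irr_p dv_p]] := leqP (size s) 1.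
  have /size_poly1P[c nz_c def_s] : size s == 1%N by rewrite eqn_leq s_le1 size_poly_gt0.
  exists (tscal (c^-1)%:P * y).
  rewrite mulrA -tscalC -mulrA -def_sx mulrA -rmorphM def_s -polyCM mulVf //.
  by rewrite rmorph1 mul1r.
have [||dv_y] := gauss_prime (B := B) (s := p) (a := d) (b := y) irr_p.
- by move=> w; rewrite -def_sx tcoefZ dvdp_mulr.
- by case: (prim_d p irr_p) => w /negP ndv dv; case: ndv.
have nz_p := irredp_neq0 irr_p.
have [y' def_y] := tscal_dvd nz_p dv_y.
have def_s := divpK dv_p; have nz_r : s %/ p != 0.
  by apply: contraNneq nz_s => r0; rewrite -def_s r0 mul0r.
apply: (IHn (s %/ p)) (nz_r) _; last first.
  apply: (@tpoly_mulfI _ _ _ B (tscal p)); first by rewrite tscal_eq0.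
  by rewrite mulrA -rmorphM mulrC def_s def_sx def_y !mulrA tscalC.
rewrite ltnS in lt_n; apply: leq_trans lt_n.
have -> : size s = (size (s %/ p) + size p).-1 by rewrite -size_mul // def_s.
rewrite -subn1 -addnBA ?size_poly_gt0 //.
by rewrite -[ltnLHS]addn0 ltn_add2l subn_gt0; case: irr_p.
Qed.

Lemma primitive_part d :
  d != 0 -> exists s d', [/\ s != 0, d = tscal s * d' & primitive d'].
Proof.
have [n] := ubnP (size d); elim: n d => // n IHn d lt_n nz_d.
have [prim_d|imp_d] := classic (primitive d).
  by exists 1, d; rewrite oner_eq0 rmorph1 mul1r.
have [s irr_s dv_s] : exists2 s, irreducible_poly s & forall w, s %| tcoef w d.
  apply: NNPP => none; case: imp_d => s irr_s.
  have [dv_s|//] := dvd_tcoefVN B s d.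
  by case: none; exists s.
have nz_s := irredp_neq0 irr_s; have [d' def_d] := tscal_dvd nz_s dv_s.
have nz_d' : d' != 0 by apply: contraNneq nz_d => d'0; rewrite def_d d'0 mulr0.
have [|r [d2 [nz_r def_d' prim_d2]]] := IHn d' _ nz_d'.
  rewrite ltnS in lt_n; apply: leq_trans lt_n.
  rewrite def_d wpoly_size_mul ?tscal_eq0 // size_tscal addnC -subn1 -addnBA ?size_poly_gt0 //.
  by rewrite -[ltnLHS]addn0 ltn_add2l subn_gt0; case: irr_s.
exists (s * r), d2; split=> //; first by rewrite mulf_neq0.
by rewrite def_d def_d' mulrA rmorphM.
Qed.

(** Replacing the divisor found by the weak algorithm by its primitive part makes
    it a divisor of a and b in R[t] itself; a denominator remains only in the
    Bezout relation. *)
Lemma saturated_gcld a b : a != 0 -> b != 0 -> a * b = b * a ->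
  exists d a' b' x y s, [/\ s != 0 /\ saturated d, a = d * a', b = d * b' &
    tscal s * d = a * x + b * y].
Proof.
move=> nz_a nz_b Cab.
have [d [a' [b' [x [y [s [s' [nz_s nz_s' def_a def_b def_d]]]]]]]] :=
  weak_algorithm B nz_a nz_b nz_b Cab.
have nz_d : d != 0.
  apply: contraNneq nz_a => d0; move/eqP: def_a.
  by rewrite d0 mul0r (tpoly_mulf_eq0 B) tscal_eq0 (negPf nz_s).
have [r [d0 [nz_r def_d0 prim_d0]]] := primitive_part nz_d.
have sat_d0 := primitive_saturated prim_d0.
rewrite def_d0 [tscal r * d0]tscalC in def_a def_b.
rewrite -mulrA in def_a; rewrite -mulrA in def_b.
have [[a2 def_a2] [b2 def_b2]] := (sat_d0 _ _ _ nz_s def_a, sat_d0 _ _ _ nz_s def_b).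
exists d0, a2, b2, x, y, (s' * r); split; rewrite ?mulf_neq0 //.
by rewrite rmorphM -mulrA -def_d0.
Qed.

End Saturation.

(** * Slopes of words in commuting elements *)

Section Slopes.
Variables (X : choiceType) (b : nat) (dig : X -> nat).
Hypothesis b_gt1 : (1 < b)%N.
Implicit Types (u v w : seq X) (r : rat).

(** The value of u as a numeral in base b; digits need not be smaller than b. *)
Definition wval u : nat := foldl (fun n x => n * b + dig x)%N 0%N u.

(** Proportional, with a positive factor for nonempty u, to the difference between
    the slope val u / (b ^ |u| - 1) of u and r. Unlike the slope it is defined
    for the empty word, and it satisfies the cocycle identity [wdefect_cat]. *)
Definition wdefect r u : rat := (wval u)%:R - r * ((b ^ size u)%:R - 1).

Lemma wval_rcons u x : wval (rcons u x) = (wval u * b + dig x)%N.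
Proof. by rewrite /wval foldl_rcons. Qed.

Lemma wval_cat u v : wval (u ++ v) = (wval u * b ^ size v + wval v)%N.
Proof.
elim/last_ind: v => [|v x IHv]; first by rewrite cats0 muln1 addn0.
rewrite -rcons_cat !wval_rcons IHv size_rcons.
by rewrite expnSr mulnDl mulnA addnA.
Qed.

Lemma wdefect_nil r : wdefect r [::] = 0.
Proof. by rewrite /wdefect /= expn0 subrr mulr0 subr0. Qed.

Lemma wdefect_cat r u v :
  wdefect r (u ++ v) = (b ^ size v)%:R * wdefect r u + wdefect r v.
Proof.
rewrite /wdefect wval_cat size_cat expnD natrD !natrM.
set x := (b ^ size u)%:R; set y := (b ^ size v)%:R.
set m := (wval u)%:R; set n := (wval v)%:R.
ring.
Qed.

Lemma wbase_ge1 u : 1 <= (b ^ size u)%:R :> rat.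
Proof. by rewrite (ler_nat _ 1) expn_gt0 ltnW. Qed.

Lemma wbase_gt1 u : u != [::] -> 1 < (b ^ size u)%:R :> rat.
Proof. by case: u => // x u _; rewrite (ltr_nat _ 1) -(expn0 b) ltn_exp2l. Qed.

Lemma wdefect_le r r' u : r <= r' -> wdefect r' u <= wdefect r u.
Proof.
move=> le_r; rewrite lerD2l lerN2 ler_wpM2r // subr_ge0; exact: wbase_ge1.
Qed.

Lemma wdefect_lt r r' u : u != [::] -> r < r' -> wdefect r' u < wdefect r u.
Proof.
move=> nz_u lt_r; rewrite ltrD2l ltrN2 ltr_pM2r // subr_gt0; exact: wbase_gt1.
Qed.

Variables (K : fieldType) (R : algType K) (B : word_basis X R).
Local Notation wcoef := (wcoef B).
Local Notation wsupp := (wsupp B).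
Implicit Types (f g : R).

Definition wscalar f := f = (wcoef [::] f)%:A.

Lemma wscalarPn f : ~ wscalar f -> exists2 u, u != [::] & wcoef u f != 0.
Proof.
move=> nsc_f; pose S := [seq u <- wsupp f | (u != [::]) && (wcoef u f != 0)].
have [/hasP[u]|/hasPn none] := boolP (has xpredT S).
  by rewrite mem_filter => /andP[/andP[]]; exists u.
case: nsc_f; apply/eqP; rewrite -subr_eq0; apply/eqP/(wcoefP B) => w.
rewrite raddfB /= wcoefA; have [->|nz_w] := eqVneq w [::]; first by rewrite subrr.
apply/eqP; rewrite subr0; apply: contraTT isT => nz_fw.
by have := none w; rewrite mem_filter nz_w nz_fw wcoef_supp // => /(_ isT).
Qed.

Lemma max_slope f : ~ wscalar f -> exists r,
  (forall u, wcoef u f != 0 -> wdefect r u <= 0) /\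
  (exists u, [/\ u != [::], wcoef u f != 0 & wdefect r u = 0]).
Proof.
move=> /wscalarPn[u0 nz_u0 fu0].
pose slope u : rat := (wval u)%:R / ((b ^ size u)%:R - 1).
have slopeE r u : u != [::] -> wdefect r u = (slope u - r) * ((b ^ size u)%:R - 1).
  move=> nz_u; rewrite mulrBl divfK // subr_eq0.
  by rewrite gt_eqF // wbase_gt1.
pose S := [seq u <- wsupp f | (u != [::]) && (wcoef u f != 0)].
have [|u] := @seq_argmax _ _ _ slope S u0; first by rewrite mem_filter nz_u0 fu0 wcoef_supp.
rewrite mem_filter => /andP[/andP[nz_u fu] _] max_u; exists (slope u); split; last first.
  by exists u; rewrite slopeE // subrr mul0r.
move=> v fv; have [->|nz_v] := eqVneq v [::]; first by rewrite wdefect_nil.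
rewrite slopeE // mulr_le0_ge0 ?subr_le0 ?subr_ge0 ?wbase_ge1 //.
by apply: max_u; rewrite mem_filter nz_v fv wcoef_supp.
Qed.

(** Suppose that some word v of g has defect 0, and let u be a word of f of maximal
    defect, both as long as possible. Then v u occurs in g f with defect that of u.
    But a word u' v' of f g has defect b ^ |v'| times that of u', plus that of v',
    and v' is not empty: this is strictly below the defect of u. *)
Lemma comm_defect_lt0 r f g :
    f * g = g * f -> f != 0 -> wcoef [::] g = 0 ->
    (forall u, wcoef u f != 0 -> wdefect r u < 0) ->
    (forall v, wcoef v g != 0 -> wdefect r v <= 0) ->
  forall v, wcoef v g != 0 -> wdefect r v < 0.
Proof.
move=> Cfg nz_f g0 f_lt g_le v0 gv0; rewrite lt_def g_le // andbT eq_sym.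
apply/negP => /eqP v0_0.
pose Sg := [seq v <- wsupp g | (wcoef v g != 0) && (wdefect r v == 0)].
have inSg v : wcoef v g != 0 -> wdefect r v = 0 -> v \in Sg.
  by move=> gv v_0; rewrite mem_filter gv v_0 eqxx wcoef_supp.
have [v] := seq_argmax size (inSg _ gv0 v0_0).
rewrite mem_filter => /andP[/andP[gv /eqP v_0] _] max_v.
have [u0 fu0] : exists u, wcoef u f != 0.
  have [u] := longest_word0 B (a := f%:P) ltac:(by rewrite polyC_eq0).
  by rewrite tcoefC polyC_eq0; exists u.
pose Sf := [seq u <- wsupp f | wcoef u f != 0].
have inSf u : wcoef u f != 0 -> u \in Sf by move=> fu; rewrite mem_filter fu wcoef_supp.
have [u1] := seq_argmax (wdefect r) (inSf _ fu0).
rewrite mem_filter => /andP[fu1 _] max_u1.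
pose Sf1 := [seq u <- Sf | wdefect r u == wdefect r u1].
have [|u] := @seq_argmax _ _ _ size Sf1 u1; first by rewrite mem_filter eqxx inSf.
rewrite !mem_filter => /and3P[/eqP u_u1 fu _] max_u.
have max_fu u' : wcoef u' f != 0 -> wdefect r u' <= wdefect r u.
  by move=> fu'; rewrite u_u1; apply/max_u1/inSf.
have vu_u : wdefect r (v ++ u) = wdefect r u by rewrite wdefect_cat v_0 mulr0 add0r.
have: wcoef (v ++ u) (g * f) = wcoef v g * wcoef u f.
  have lt_v : (size v < (size (v ++ u)).+1)%N by rewrite ltnS size_cat leq_addr.
  rewrite wcoefM (bigD1 (Ordinal lt_v)) //= take_size_cat // drop_size_cat //.
  rewrite big1 ?addr0 // => i ne_i; apply/eqP; rewrite mulf_eq0; apply/norP.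
  set v' := take i _; set u' := drop i _ => -[gv' fu'].
  have def_vu : v' ++ u' = v ++ u by exact: cat_take_drop.
  have := wdefect_cat r v' u'; rewrite def_vu vu_u => def_u.
  have le_v' := g_le _ gv'; have le_u' := max_fu _ fu'.
  have b1 := wbase_ge1 u'.
  have v'_0 : wdefect r v' = 0.
    apply/eqP; rewrite eq_le le_v' /= -(pmulr_rge0 _ (lt_le_trans ltr01 b1)).
    by rewrite -(lerD2r (wdefect r u')) -def_u add0r.
  have u'_u : wdefect r u' = wdefect r u by rewrite def_u v'_0 mulr0 add0r.
  have := max_v _ (inSg _ gv' v'_0); have: u' \in Sf1 by rewrite mem_filter u'_u u_u1 eqxx inSf.
  move/max_u; rewrite !leEnat => le_u le_v.
  have := congr1 size def_vu; rewrite !size_cat => def_sz.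
  have sz_v' : size v' = i by rewrite size_takel // -ltnS.
  case/eqP: ne_i; apply: val_inj; rewrite /= -sz_v'; move: le_u le_v def_sz.
  move: (size v') (size u') (size v) (size u) => n1 n2 n3 n4; clear; lia.
rewrite -Cfg wcoefM big1 => [/esym/eqP|i _]; first by rewrite mulf_eq0 (negPf gv) (negPf fu).
set u' := take i _; set v' := drop i _.
apply/eqP; rewrite mulf_eq0; apply/norP => -[fu' gv'].
have def_vu : u' ++ v' = v ++ u by exact: cat_take_drop.
have := wdefect_cat r u' v'; rewrite def_vu vu_u => def_u.
have nz_v' : v' != [::] by apply: contraNneq gv' => ->; rewrite g0.
have le_v' := g_le _ gv'; have le_u' := max_fu _ fu'; have lt_u := f_lt _ fu.
have b1 := wbase_gt1 nz_v'.
suff: wdefect r u < wdefect r u by rewrite ltxx.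
rewrite {1}def_u; apply: (lt_le_trans _ (le_u')).
rewrite -[ltRHS]addr0 ltr_leD // -[ltRHS]mul1r ltr_nM2r //.
exact: le_lt_trans le_u' lt_u.
Qed.

(** The maximal slope of g does not exceed that of f; otherwise
    [comm_defect_lt0] applies with r the maximal slope of g, after removing the
    constant terms. *)
Lemma comm_defect_le0 r f g : f * g = g * f -> ~ wscalar f ->
    (forall u, wcoef u f != 0 -> wdefect r u <= 0) ->
  forall v, wcoef v g != 0 -> wdefect r v <= 0.
Proof.
move=> Cfg nsc_f f_le v gv.
have [nil_v|nz_v] := eqVneq v [::]; first by rewrite nil_v wdefect_nil.
have [|r1 [g_le [w [nz_w gw w_0]]]] := @max_slope g.
  by move=> sc_g; move: gv; rewrite sc_g wcoefA (negPf nz_v) eqxx.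
have [le_r|lt_r] := leP r1 r; first exact: le_trans (wdefect_le _ le_r) (g_le _ gv).
pose f' := f - (wcoef [::] f)%:A; pose g' := g - (wcoef [::] g)%:A.
have Calg c (x : R) : GRing.comm x c%:A.
  by rewrite /GRing.comm -scalerAl -scalerAr mul1r mulr1.
have Cfg' : GRing.comm f' g'.
  apply: commrB (Calg _ _); apply/commr_sym; apply: commrB (Calg _ _).
  exact: commr_sym.
have coef' (h : R) (u : seq X) : wcoef u (h - (wcoef [::] h)%:A) = wcoef u h *+ (u != [::]).
  by rewrite raddfB /= wcoefA; case: eqP => [->|_]; rewrite ?subrr ?subr0.
have nz_f' : f' != 0 by rewrite subr_eq0; apply/eqP.
suff: wdefect r1 w < 0 by rewrite w_0 ltxx.
apply: (comm_defect_lt0 Cfg' nz_f'); rewrite ?coef' ?nz_w //.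
- move=> u; rewrite coef'; have [_|nz_u fu] := eqVneq u [::]; first by rewrite eqxx.
  exact: lt_le_trans (wdefect_lt nz_u lt_r) (f_le _ fu).
- move=> u; rewrite coef'; have [_|nz_u gu] := eqVneq u [::]; first by rewrite eqxx.
  exact: g_le.
Qed.

(** By symmetry commuting non-scalar elements have the same maximal slope. *)
Lemma comm_defect_eq0 r f g u : f * g = g * f -> ~ wscalar f -> ~ wscalar g ->
    (forall u, wcoef u f != 0 -> wdefect r u <= 0) ->
    u != [::] -> wcoef u f != 0 -> wdefect r u = 0 ->
  exists v, [/\ v != [::], wcoef v g != 0 & wdefect r v = 0].
Proof.
move=> Cfg nsc_f nsc_g f_le nz_u fu u_0.
have [r1 [g_le [v [nz_v gv v_0]]]] := max_slope nsc_g.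
exists v; split=> //; have le_v := comm_defect_le0 Cfg nsc_f f_le gv.
have le_u := comm_defect_le0 (esym Cfg) nsc_g g_le fu.
have -> // : r = r1; apply: le_anti; apply/andP; split; rewrite leNgt; apply/negP.
  by move=> /(wdefect_lt nz_u); rewrite u_0 ltNge le_u.
by move=> /(wdefect_lt nz_v); rewrite v_0 ltNge le_v.
Qed.

End Slopes.

(** * Embedding the centralizer into K[t] *)

Section Embedding.
Variables (K : fieldType) (X : choiceType) (R : algType K).
Variable B : word_basis X R.
Local Notation wcoef := (wcoef B).
Local Notation wsupp := (wsupp B).
Local Notation wscalar := (wscalar B).
Implicit Types (f g h : R) (u v w : seq X) (S : seq X).

Lemma wval_eq0 b (dig : X -> nat) u :
  (0 < b)%N -> wval b dig u = 0%N -> all (fun x => dig x == 0%N) u.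
Proof.
move=> b_gt0; elim/last_ind: u => // u x IHu.
rewrite wval_rcons all_rcons => /eqP; rewrite addn_eq0 muln_eq0.
by rewrite -[b == _]leqn0 leqNgt b_gt0 orbF => /andP[/eqP/IHu-> ->].
Qed.

Lemma wval_inj S b (dig : X -> nat) u v :
    {in S &, injective dig} -> (forall x, (dig x < b)%N) ->
    {subset u <= S} -> {subset v <= S} -> size u = size v ->
  wval b dig u = wval b dig v -> u = v.
Proof.
move=> dig_inj dig_lt; elim/last_ind: u v => [|u x IHu] v.
  by move=> _ _ /esym/size0nil->.
case/lastP: v => [|v y]; first by rewrite size_rcons.
move=> Su Sv; rewrite !size_rcons !wval_rcons => -[eq_sz] eq_val.
have b_gt0 : (0 < b)%N by apply: leq_ltn_trans (dig_lt x).
have eq_d : dig x = dig y.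
  by have := congr1 (modn^~ b) eq_val; rewrite /= !modnMDl !modn_small.
have eq_u : wval b dig u = wval b dig v.
  by have := congr1 (divn^~ b) eq_val; rewrite /= !divnMDl // !divn_small // !addn0.
have -> : x = y by apply: dig_inj => //; [apply: Su|apply: Sv]; rewrite mem_rcons mem_head.
congr rcons; apply: IHu => // z z_in.
  by apply: Su; rewrite mem_rcons in_cons z_in orbT.
by apply: Sv; rewrite mem_rcons in_cons z_in orbT.
Qed.

(** Give the letters of S the digit 0 and all others the digit 1: every word of f
    has slope 0, so every word of g has slope at most 0. *)
Lemma comm_letters S f g : f * g = g * f -> ~ wscalar f ->
    (forall u, wcoef u f != 0 -> {subset u <= S}) ->
  forall v, wcoef v g != 0 -> {subset v <= S}.
Proof.
move=> Cfg nsc_f fS v gv; pose dig x : nat := x \notin S.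
have val0 u : {subset u <= S} -> wval 2 dig u = 0%N.
  elim/last_ind: u => // u x IHu Su; rewrite wval_rcons IHu.
    by rewrite /dig Su // mem_rcons mem_head.
  by move=> z z_in; apply: Su; rewrite mem_rcons in_cons z_in orbT.
have := comm_defect_le0 (isT : (1 < 2)%N) (dig := dig) (r := 0) Cfg nsc_f _ gv.
rewrite /wdefect mul0r subr0 => /(_ _)/wrap[u fu|].
  by rewrite /wdefect mul0r subr0 val0 // => x; apply: fS.
rewrite (ler_nat _ _ 0) leqn0 => /eqP/(wval_eq0 (isT : (0 < 2)%N))/allP digs x /digs.
by rewrite /dig eqb0 negbK.
Qed.

(** Phi keeps the words of maximal slope r, sent to powers of t. Distinct letters
    of f get distinct digits below the base, so that a word written with
    them is determined by its length and its slope: the words kept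
    are sent to distinct powers of t, and Phi is injective on the centralizer
    because each non-scalar element of it has a nonempty word of slope r. *)
Lemma centralizer_embedding f : ~ wscalar f -> exists Phi : R -> {poly K},
  [/\ zmod_morphism Phi, forall c g, Phi (c *: g) = c *: Phi g, Phi 1 = 1,
      forall g h, f * g = g * f -> f * h = h * f -> Phi (g * h) = Phi g * Phi h
    & forall g, f * g = g * f -> Phi g = 0 -> g = 0].
Proof.
move=> nsc_f; pose S := flatten (wsupp f).
have fS u : wcoef u f != 0 -> {subset u <= S}.
  by move=> /wcoef_supp u_in x x_u; apply/flattenP; exists u.
(* Letters outside S share the digit [size S], which is still below the base. *)
pose dig x := index x S; pose b := (size S).+2.
have b_gt1 : (1 < b)%N by [].
have [r [f_le [u [nz_u fu u_0]]]] := max_slope dig b_gt1 nsc_f.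
pose defect := wdefect b dig r.
pose term w : {poly K} := if defect w == 0 then 'X^(size w) else 0.
have term1 : term [::] = 1 by rewrite /term /defect wdefect_nil eqxx.
exists (wext B term); split.
- exact: wextB.
- exact: wextZ.
- rewrite (wextE term (T := [:: [::]])) // => [|w].
    by rewrite big_seq1 wcoef1 term1 scale1r.
  by rewrite wcoef1 inE; case: (w == [::]) => //=; rewrite eqxx.
- move=> g h Cfg Cfh; apply: wextM => v w gv hw.
  have v_le : defect v <= 0 := comm_defect_le0 b_gt1 Cfg nsc_f f_le gv.
  have w_le : defect w <= 0 := comm_defect_le0 b_gt1 Cfh nsc_f f_le hw.
  rewrite /term /defect wdefect_cat -/defect size_cat exprD.
  have b_gt0 := lt_le_trans ltr01 (wbase_ge1 b_gt1 w).
  have [v_0|nz_v] := eqVneq (defect v) 0.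
    by rewrite v_0 mulr0 add0r; case: ifP; rewrite ?mulr0.
  rewrite mul0r lt_eqF // ltr_wnDr // pmulr_rlt0 //.
  by rewrite lt_neqAle nz_v.
move=> g Cfg Phi_g.
have [sc_g|nsc_g] := eqVneq g (wcoef [::] g)%:A.
  move: Phi_g; rewrite sc_g wextZ; set c := wcoef _ _.
  rewrite (wextE term (T := [:: [::]])) // => [|w].
    rewrite big_seq1 wcoef1 term1 scale1r => /eqP.
    by rewrite -mul_polyC mulr1 polyC_eq0 => /eqP->; rewrite scale0r.
  by rewrite wcoef1 inE; case: (w == [::]) => //=; rewrite eqxx.
have [v [_ gv v_0]] := comm_defect_eq0 b_gt1 Cfg nsc_f (elimN eqP nsc_g) f_le nz_u fu u_0.
have gS := comm_letters Cfg nsc_f fS.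
suff: wcoef v g == 0 by rewrite (negPf gv).
rewrite -[0](coef0 K (size v)) -Phi_g /wext coef_sum.
rewrite (bigD1_seq v) ?wsupp_uniq ?wcoef_supp //= big1 => [|w ne_wv].
  by rewrite coefZ /term /defect v_0 eqxx coefXn eqxx mulr1 addr0.
have [->|gw] := eqVneq (wcoef w g) 0; first by rewrite scale0r coef0.
rewrite coefZ /term; case: eqP => [w_0|_]; last by rewrite coef0 mulr0.
rewrite coefXn; case: eqP => [eq_sz|_]; last by rewrite mulr0.
case/eqP: ne_wv; apply: (@wval_inj S b dig); rewrite //.
- by move=> x y x_S y_S; apply: index_inj.
- by move=> x; rewrite /b ltnS ltnW // ltnS index_size.
- exact: gS.
- exact: gS.
move/eqP: w_0; rewrite /defect /wdefect subr_eq0 => /eqP w_0.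
move/eqP: v_0; rewrite /wdefect subr_eq0 => /eqP v_0.
by apply/eqP; rewrite -(eqr_nat rat) w_0 v_0 eq_sz.
Qed.

End Embedding.

(** * Left divisors of f - s(t) *)

Section Divisors.
Variables (K : fieldType) (X : choiceType) (R : algType K).
Variable B : word_basis X R.
Local Notation wcoef := (wcoef B).
Local Notation wscalar := (wscalar B).
Local Notation tcoef := (tcoef B).
Local Notation tscal := (tscal R).
Implicit Types (f g h : R) (a d : {poly R}) (s : {poly K}).

(** Longest words multiply, so the longest word of g is empty. *)
Lemma scalar_factorl g h (c : K) :
  c != 0 -> g * h = c%:A -> exists2 e : K, e != 0 & g = e%:A.
Proof.
move=> nz_c def_c.
have nz_gh : g * h != 0 by rewrite def_c scaler_eq0 oner_eq0 orbF.
have [nz_g nz_h] : g%:P != 0 /\ h%:P != 0.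
  by apply/norP; rewrite !polyC_eq0 -(word_mulf_eq0 B).
have [u nz_u max_u] := longest_word0 B nz_g.
have [v nz_v max_v] := longest_word0 B nz_h.
have := tcoefM_longest0 max_u max_v.
rewrite -polyCM def_c [LHS]tcoefC wcoefA; case: u nz_u max_u => [|x u] nz_u max_u; last first.
  by move/esym/eqP; rewrite mulf_eq0 (negPf nz_u) (negPf nz_v).
move=> _; exists (wcoef [::] g); first by rewrite tcoefC polyC_eq0 in nz_u.
apply/eqP; rewrite -subr_eq0; apply/eqP/(wcoefP B) => w.
rewrite raddfB /= wcoefA; case: w => [|x w]; rewrite ?subrr //= subr0.
by apply/eqP; rewrite -polyC_eq0 -tcoefC max_u.
Qed.

Section DivisorsOf.
Variables (f : R) (s : {poly K}).
Hypotheses (nsc_f : ~ wscalar f) (s_gt1 : (1 < size s)%N).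
Let F : {poly R} := f%:P - tscal s.

Lemma shift_lead : size F = size s /\ lead_coef F = (- lead_coef s)%:A.
Proof.
have lt_f : (size f%:P < size (- tscal s))%N.
  rewrite size_polyN size_tscal; exact: leq_ltn_trans (size_polyC_leq1 _) s_gt1.
rewrite /F addrC size_polyDl // lead_coefDl // size_polyN size_tscal lead_coefN.
by rewrite lead_coef_map /= scaleNr.
Qed.

Lemma shift_neq0 : F != 0.
Proof. by rewrite -size_poly_gt0 shift_lead.1 ltnW. Qed.

(** A content of d would divide the coefficient of F on a nonempty word of f,
    which is a nonzero constant. *)
Lemma divisor_primitive d a : F = d * a -> primitive B d.
Proof.
move=> def_F p irr_p; have [dv_d|//] := dvd_tcoefVN B p d.
have [d' def_d] := tscal_dvd (irredp_neq0 irr_p) dv_d.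
have [w nz_w fw] := wscalarPn nsc_f.
have: p %| tcoef w F by rewrite def_F def_d -mulrA tcoefZ dvdp_mulr.
rewrite /F raddfB /= tcoefC -[tscal s]mulr1 tcoefZ -[1]/(1%:P) tcoefC wcoef1.
rewrite (negPf nz_w) mulr0 subr0 => /dvdp_leq.
rewrite polyC_eq0 fw size_polyC fw leqNgt => /(_ isT)/negP; case.
by case: irr_p.
Qed.

(** Degrees in t show that f' is constant in t, and leading coefficients in t
    that it equals f, because the leading coefficient of d is a factor of the
    scalar leading coefficient of F. *)
Lemma divisor_commutes d a (f' : {poly R}) :
  F = d * a -> f%:P * d = d * f' -> f%:P * d = d * f%:P.
Proof.
move=> def_F fd; have [_ lF] := shift_lead.
have nz_s : s != 0 by rewrite -size_poly_gt0 ltnW.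
have [nz_d nz_a] : d != 0 /\ a != 0.
  by apply/norP; rewrite -(tpoly_mulf_eq0 B) -def_F shift_neq0.
have nz_f : f%:P != 0.
  rewrite polyC_eq0; apply/eqP => f0; apply: nsc_f.
  by rewrite /wscalar f0 raddf0 scale0r.
have [c nz_c def_c] : exists2 c : K, c != 0 & lead_coef d = c%:A.
  apply: (@scalar_factorl _ (lead_coef a) (- lead_coef s)).
    by rewrite oppr_eq0 lead_coef_eq0.
  by rewrite -(wpoly_lead_coefM B) -def_F.
have nz_f' : f' != 0.
  have: f%:P * d != 0 by rewrite (tpoly_mulf_eq0 B) negb_or nz_f.
  by rewrite fd (tpoly_mulf_eq0 B) negb_or => /andP[].
have /size_poly1P[g nz_g def_f'] : size f' == 1%N.
  have := congr1 (fun x : {poly R} => size x) fd.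
  rewrite /= !(wpoly_size_mul B) // size_polyC -polyC_eq0 nz_f.
  move: nz_d nz_f'; rewrite -!size_poly_gt0; move: (size d) (size f') => m n.
  case: m n => [|m] [|n] //= _ _ /eqP.
  by rewrite add0n addnS eqSS -[X in X == _]addn0 eqn_add2l eq_sym.
have := congr1 (fun x : {poly R} => lead_coef x) fd.
rewrite /= !(wpoly_lead_coefM B) def_f' !lead_coefC def_c.
rewrite -scalerAl -scalerAr mul1r mulr1 => /(scalerI nz_c) def_f.
by rewrite fd def_f' -def_f.
Qed.

End DivisorsOf.
End Divisors.

(** * The kernel of a point of the centralizer *)

Lemma ex_minimal (T : Type) (m : T -> nat) (P : T -> Prop) x0 :
  P x0 -> exists2 x, P x & forall y, P y -> (m x <= m y)%N.
Proof.
have [n] := ubnP (m x0); elim: n x0 => // n IHn x0 lt_n Px0.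
have [[y [Py lt_y]]|none] := classic (exists y, P y /\ (m y < m x0)%N).
  by apply: (IHn y) => //; apply: leq_trans lt_y _.
exists x0 => // y Py; rewrite leqNgt; apply/negP => lt_y.
by apply: none; exists y.
Qed.

Section Centralizer.
Variables (K : fieldType) (X : choiceType) (R : algType K).
Variables (B : word_basis X R) (f : R).
Hypothesis nsc_f : ~ wscalar B f.
Local Notation C := (centralizer f).
Local Notation tscal := (tscal R).

Variable phi : {rmorphism C -> {poly K}}.
Hypotheses (phi_inj : injective phi) (phiA : forall c : K, phi c%:A = c%:P).

Let emb : {poly C} -> {poly R} := map_poly (\val : C -> R).
HB.instance Definition _ := GRing.RMorphism.copy emb (map_poly (\val : C -> R)).
Let cscal : {poly K} -> {poly C} := map_poly (in_alg C).
HB.instance Definition _ := GRing.RMorphism.copy cscal (map_poly (in_alg C)).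
(** The extension of phi to C[t] that fixes t. *)
Let spec : {poly C} -> {poly K} := horner_eval 'X \o map_poly phi.
HB.instance Definition _ :=
  GRing.RMorphism.copy spec (horner_eval 'X \o map_poly phi).

Lemma centP_mulC (x y : {poly C}) : x * y = y * x.
Proof.
apply: (map_inj_poly phi_inj (rmorph0 _)).
by rewrite !rmorphM mulrC.
Qed.

Lemma embC (c : C) : emb c%:P = (val c)%:P.
Proof. exact: map_polyC. Qed.

Lemma embM x y : emb (x * y) = emb x * emb y.
Proof. exact: rmorphM. Qed.

Lemma lead_coef_emb x : lead_coef (emb x) = val (lead_coef x).
Proof. by apply: lead_coef_map_inj; [exact: val_inj | exact: rmorph0]. Qed.

Lemma emb_inj : injective emb.
Proof. by apply: map_inj_poly; [exact: val_inj | exact: rmorph0]. Qed.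

Lemma size_emb x : size (emb x) = size x.
Proof. by apply: size_map_inj_poly; [exact: val_inj | exact: rmorph0]. Qed.

Lemma emb_eq0 x : (emb x == 0) = (x == 0).
Proof. by rewrite -!size_poly_eq0 size_emb. Qed.

Lemma emb_cscal s : emb (cscal s) = tscal s.
Proof. by apply/polyP => i; rewrite !coef_map. Qed.

(** C[t] is the centralizer of f in R[t]. *)
Lemma emb_surj (y : {poly R}) : f%:P * y = y * f%:P -> exists x, y = emb x.
Proof.
move=> Cfy; have Cy i : y`_i \in centralizer_pred f.
  have := congr1 (fun p : {poly R} => p`_i) Cfy.
  by rewrite /= coefCM coefMC => /esym/centralizerP.
exists (\poly_(i < size y) Centralizer (Cy i)); apply/polyP => i.
rewrite coef_map coef_poly; case: ltnP => // le_y; first by rewrite raddf0 nth_default.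
Qed.

Lemma emb_comm x : f%:P * emb x = emb x * f%:P.
Proof.
apply/polyP => i; rewrite coefCM coefMC coef_map.
by apply/esym/centralizerP/valP.
Qed.

Lemma centP_mulf_eq0 (x y : {poly C}) : (x * y == 0) = (x == 0) || (y == 0).
Proof. by rewrite -!emb_eq0 embM (tpoly_mulf_eq0 B). Qed.

Lemma centP_size_mul (x y : {poly C}) :
  x != 0 -> y != 0 -> size (x * y) = (size x + size y).-1.
Proof.
by move=> nz_x nz_y; rewrite -!size_emb embM (wpoly_size_mul B) ?emb_eq0.
Qed.

Lemma specC c : spec c%:P = phi c.
Proof. by rewrite /spec /= map_polyC /horner_eval hornerC. Qed.

Lemma spec_cscal s : spec (cscal s) = s.
Proof.
rewrite /spec /= /horner_eval.
have -> : map_poly phi (cscal s) = map_poly polyC s.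
  by apply/polyP => i; rewrite !coef_map /= phiA.
by rewrite -[_.['X]]/(s \Po 'X) comp_polyXr.
Qed.

Let cf : C := Centralizer (introT (centralizerP f f) erefl).
Let s := phi cf.
Let F : {poly C} := cf%:P - cscal s.

Lemma spec_F : spec F = 0.
Proof. by rewrite /F rmorphB /= specC spec_cscal subrr. Qed.

Lemma emb_F : emb F = f%:P - tscal s.
Proof. by rewrite /F rmorphB /= emb_cscal embC. Qed.

Lemma cent_scalar (z : C) : (size (phi z) <= 1)%N -> exists c : K, z = c%:A.
Proof.
by move=> /size1_polyC def_z; exists (phi z)`_0; apply: phi_inj; rewrite phiA.
Qed.

Lemma s_gt1 : (1 < size s)%N.
Proof.
rewrite ltnNge; apply/negP => /cent_scalar[c /(congr1 val) /= def_f].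
by apply: nsc_f; rewrite /wscalar def_f wcoefA.
Qed.

Lemma F_neq0 : F != 0.
Proof. by rewrite -emb_eq0 emb_F (shift_neq0 _ s_gt1). Qed.

(** Let g be a nonzero element of minimal degree in t of the ideal (a, b) of C[t].
    It has positive degree, since phi is injective while a and b are in the
    kernel. Pseudo-division by g writes multiples of a and b by constants of C as
    e g and e' g; this yields e2 of smaller degree than a with e2 b in a C[t].
    Multiplying the relation by e2 gives r e2 in a R[t], hence e2 in a R[t]
    because a is primitive, against the degrees. *)
Lemma no_bezout (a b u : {poly C}) (r : {poly K}) (p q : {poly R}) :
    F = a * u -> spec a = 0 -> spec b = 0 ->
  tscal r = emb a * p + emb b * q -> r = 0.
Proof.
move=> def_F a0 b0 def_r; apply/eqP/negPn/negP => nz_r.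
have nz_a : a != 0 by apply: contraNneq F_neq0 => az; rewrite def_F az mul0r.
have sat_a : saturated (emb a).
  apply: (primitive_saturated (B := B)); apply: (divisor_primitive nsc_f (s := s) (a := emb u)).
  by rewrite -emb_F def_F embM.
have [|g [nz_g [y1 [y2 def_g]]] min_g] := @ex_minimal _ (fun g : {poly C} => size g)
    (fun g => g != 0 /\ exists y1 y2, g = a * y1 + b * y2) a.
  by split=> //; exists 1, 0; rewrite mulr1 mulr0 addr0.
have g_gt1 : (1 < size g)%N.
  rewrite ltnNge; apply/negP => /size1_polyC def_gC; case/eqP: nz_g.
  have : spec g = 0 by rewrite def_g rmorphD !rmorphM /= a0 b0 !mul0r addr0.
  rewrite def_gC specC => phi0; congr _%:P; apply: phi_inj.
  by rewrite phi0 rmorph0.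
set l := lead_coef g; have nz_l : l != 0 by rewrite lead_coef_eq0.
have dv_g h y3 y4 : h = a * y3 + b * y4 -> exists k e, h * (l ^+ k)%:P = e * g.
  move=> def_h; exists (Pdiv.CommonRing.rscalp h g), (Pdiv.CommonRing.rdivp h g).
  have := Pdiv.RingComRreg.rdivp_eq (centP_mulC _ _ : GRing.comm g _) h.
  set k := Pdiv.CommonRing.rscalp h g; set e := Pdiv.CommonRing.rdivp h g.
  set t := Pdiv.CommonRing.rmodp h g => def_t.
  have [t0|nz_t] := eqVneq t 0; first by rewrite def_t t0 addr0.
  have : (size t < size g)%N by rewrite Pdiv.CommonRing.ltn_rmodp.
  rewrite ltnNge min_g //; split=> //.
  exists (y3 * (l ^+ k)%:P - y1 * e), (y4 * (l ^+ k)%:P - y2 * e).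
  rewrite !mulrBr !mulrA addrACA -opprD -!mulrDl -def_h -def_g.
  by rewrite [g * e]centP_mulC -/l in def_t *; rewrite def_t addrC addKr.
have [k1 [e def_e]] := dv_g a 1 0 ltac:(by rewrite mulr1 mulr0 addr0).
have [k2 [e' def_e']] := dv_g b 0 1 ltac:(by rewrite mulr1 mulr0 add0r).
have nz_lk k : (l ^+ k)%:P != 0 :> {poly C}.
  elim: k => [|k IHk]; first by rewrite expr0 oner_eq0.
  by rewrite exprS polyCM centP_mulf_eq0 polyC_eq0 negb_or nz_l.
have size_lk k : size (l ^+ k)%:P = 1%N :> nat.
  by have := nz_lk k; rewrite size_polyC polyC_eq0 => ->.
pose e2 := e * (l ^+ k2)%:P.
have nz_e : e != 0.
  have : a * (l ^+ k1)%:P != 0 by rewrite centP_mulf_eq0 negb_or nz_a nz_lk.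
  by rewrite def_e centP_mulf_eq0 negb_or => /andP[].
have def_e2 : e2 * b = a * (e' * (l ^+ k1)%:P).
  rewrite /e2 -mulrA [_%:P * b]centP_mulC def_e' mulrA [e * e']centP_mulC -mulrA -def_e.
  by rewrite mulrA [e' * a]centP_mulC mulrA.
have e2a : emb e2 * emb a = emb a * emb e2 by rewrite -!embM centP_mulC.
have [c e2b] : exists c, emb e2 * emb b = emb a * c.
  by exists (emb (e' * (l ^+ k1)%:P)); rewrite -!embM def_e2.
have [z def_z] : exists z, emb e2 = emb a * z.
  apply: (sat_a r _ (emb e2 * p + c * q)) => //; move: (emb e2) e2a e2b => e3 e2a e2b.
  by rewrite tscalC def_r !mulrDr !mulrA e2a e2b.
have nz_e2 : e2 != 0 by rewrite centP_mulf_eq0 negb_or nz_e nz_lk.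
have nz_z : z != 0.
  by rewrite -emb_eq0 def_z (tpoly_mulf_eq0 B) negb_or in nz_e2; case/andP: nz_e2.
have := congr1 (fun p : {poly C} => size p) def_e.
rewrite /= !centP_size_mul // size_lk addn1 /= => size_a.
have := congr1 (fun p : {poly R} => size p) def_z.
rewrite /= (wpoly_size_mul B) ?emb_eq0 // !size_emb centP_size_mul // size_lk addn1 /=.
rewrite (polySpred nz_z) addnS /= => size_e.
have : (size a <= size e)%N by rewrite size_e leq_addr.
have e_gt0 : (0 < size e)%N by rewrite size_poly_gt0.
by rewrite size_a leqNgt; case: (size g) g_gt1 => [|[|n]] // _; rewrite !addnS /= ltnS leq_addr.
Qed.

(** Let e be the common left divisor of the minimal d and of x in the kernel. It
    divides F and satisfies f e = e f', so it lies in C[t], and so do the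
    cofactors a and b. If e is in the kernel, minimality of d makes a a unit,
    and d divides x. Otherwise a and b are in the kernel, and the Bezout relation
    for e, divided by e, contradicts [no_bezout]. *)
Lemma spec_kernel : exists2 d, spec d = 0 &
  forall x, spec x = 0 -> exists y, x = d * y.
Proof.
have [|d [d0 [u def_F]] min_d] := @ex_minimal _ (fun g : {poly C} => size g)
    (fun d => spec d = 0 /\ exists u, F = d * u) F.
  by split; [exact: spec_F | exists 1; rewrite mulr1].
exists d => // x x0; have [->|nz_x] := eqVneq x 0; first by exists 0; rewrite mulr0.
have nz_d : d != 0 by apply: contraNneq F_neq0 => dz; rewrite def_F dz mul0r.
have Cdx : emb d * emb x = emb x * emb d by rewrite -!embM centP_mulC.
have [||e [a [b [p [q [r [[nz_r sat_e] def_d def_x def_e]]]]]]] := saturated_gcld B _ _ Cdx.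
- by rewrite emb_eq0.
- by rewrite emb_eq0.
have nz_e : e != 0.
  by rewrite -emb_eq0 def_d (tpoly_mulf_eq0 B) negb_or in nz_d; case/andP: nz_d.
have def_F' : f%:P - tscal s = e * (a * emb u).
  by rewrite -emb_F def_F embM def_d mulrA.
have [f' fe] : exists f', f%:P * e = e * f'.
  apply: (sat_e r _ (a * f%:P * p + b * f%:P * q)) => //.
  rewrite mulrA tscalC -mulrA def_e !mulrDr !mulrA -def_d -def_x.
  by rewrite !emb_comm.
have Ce := divisor_commutes nsc_f s_gt1 def_F' fe.
have [e1 def_e1] := emb_surj Ce.
have lift c x1 : emb x1 = e * c -> exists c1, c = emb c1.
  move=> def_c; apply: emb_surj; apply: (@tpoly_mulfI _ _ _ B e) => //.
  by rewrite !mulrA -Ce -mulrA -def_c emb_comm def_c.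
have [[a1 def_a1] [b1 def_b1]] := (lift _ _ def_d, lift _ _ def_x).
rewrite def_e1 def_a1 def_b1 -!embM in def_d def_x.
have {}def_d := emb_inj def_d; have {}def_x := emb_inj def_x.
have [e0|nz_e0] := eqVneq (spec e1) 0; last first.
  have spec0 y : spec (e1 * y) = 0 -> spec y = 0.
    by move/eqP; rewrite rmorphM mulf_eq0 (negPf nz_e0) => /eqP.
  have r0 : r = 0.
    apply: (@no_bezout a1 b1 (e1 * u) r p q) => //.
    - by rewrite mulrA [a1 * e1]centP_mulC -def_d.
    - by apply: spec0; rewrite -def_d.
    - by apply: spec0; rewrite -def_x.
    apply: (@tpoly_mulfI _ _ _ B e) => //.
    by rewrite -tscalC def_e def_e1 mulrDr !mulrA -!embM -def_d -def_x.
  by rewrite r0 eqxx in nz_r.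
have nz_e1 : e1 != 0 by rewrite -emb_eq0 -def_e1.
have nz_a1 : a1 != 0 by apply: contraNneq nz_d => az; rewrite def_d az mulr0.
have /size_poly1P[c nz_c def_a] : size a1 == 1%N.
  rewrite eqn_leq size_poly_gt0 nz_a1 andbT.
  have : (size d <= size e1)%N.
    by apply: min_d; split=> //; exists (a1 * u); rewrite mulrA -def_d.
  rewrite def_d centP_size_mul // (polySpred nz_e1) addSn /=.
  by rewrite -[leqRHS]addn1 leq_add2l.
(* The constant cofactor c is a unit because it divides the leading coefficient
   of F, which is a scalar. *)
have [k nz_k def_c] : exists2 k : K, k != 0 & val c = k%:A.
  apply: (@scalar_factorl _ _ _ B _ (val (lead_coef (e1 * u))) (- lead_coef s)).
    by rewrite oppr_eq0 lead_coef_eq0 -size_poly_gt0 ltnW ?s_gt1.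
  have [_ <-] := shift_lead f s_gt1; rewrite -emb_F.
  have -> : F = c%:P * (e1 * u) by rewrite -def_a mulrA [a1 * e1]centP_mulC -def_d.
  by rewrite embM (wpoly_lead_coefM B) embC lead_coefC lead_coef_emb.
have {}def_c : c = k%:A by apply: val_inj.
exists ((k^-1)%:A%:P * b1); rewrite def_x def_d def_a def_c -mulrA; congr (_ * _).
by rewrite mulrA -polyCM -scalerAl mul1r scalerA mulfV // scale1r mul1r.
Qed.

(** The generator is d(0), with d a generator of the kernel: specialize at t = 0
    the divisibility of c - (phi c)(t) by d. Moreover d(0) is not a scalar: a
    scalar d(0) is zero, as seen by setting t = 0 in spec d = 0, and then all of
    C would be scalar. *)
Lemma cent_generator :
  exists2 z : C, (1 < size (phi z))%N &
    forall c : C, exists k : K, exists y : C, c = k%:A + z * y.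
Proof.
have [d d0 ker_d] := spec_kernel.
have gen c : exists k : K, exists y : C, c = k%:A + d`_0 * y.
  have [|y] := ker_d (c%:P - cscal (phi c)).
    by rewrite rmorphB /= specC spec_cscal subrr.
  move/(congr1 (fun p : {poly C} => p`_0)).
  rewrite /= coefB coefC eqxx coef_map /= coef0M => /eqP.
  by rewrite subr_eq addrC => /eqP def_c; exists (phi c)`_0, y`_0.
exists d`_0 => //; rewrite ltnNge; apply/negP => /cent_scalar[k def_z].
have k0 : k = 0.
  have [d' [c def_d]] : exists p c, d = p * 'X + c%:P.
    by elim/poly_ind: (d) => [|p c _]; [exists 0, 0; rewrite mul0r addr0 | exists p, c].
  have def_c : c = k%:A by rewrite -def_z def_d coefD coefMX coefC add0r.
  have := congr1 (fun p : {poly K} => p`_0) d0.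
  rewrite /= def_d rmorphD rmorphM /= specC def_c phiA.
  by rewrite /spec /= map_polyX /horner_eval hornerX coefD coefMX coefC coef0 add0r.
have [e [y]] := gen cf; rewrite def_z k0 scale0r mul0r addr0 => def_cf.
by have := s_gt1; rewrite /s def_cf phiA size_polyC; case: (e != 0).
Qed.

(** Induction on the degree of phi c: in c = k + z y the degree of phi y is
    smaller. *)
Lemma cent_poly (z : C) : (1 < size (phi z))%N ->
    (forall c : C, exists k : K, exists y : C, c = k%:A + z * y) ->
  forall c : C, exists p : {poly K}, horner_alg z p = c.
Proof.
move=> z_gt1 gen c; have [n] := ubnP (size (phi c)); elim: n c => // n IHn c lt_n.
have [k [y def_c]] := gen c.
have [y0|nz_y] := eqVneq y 0.
  by exists k%:P; rewrite horner_algC def_c y0 mulr0 addr0.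
have nz_phi_y : phi y != 0 by rewrite raddf_eq0.
have nz_phi_z : phi z != 0 by rewrite -size_poly_gt0 ltnW.
have [|p def_y] := IHn y; last first.
  exists (k%:P + 'X * p); rewrite rmorphD rmorphM /= horner_algC horner_algX.
  by rewrite def_y def_c.
have def_phi : phi z * phi y = phi c - k%:P.
  by rewrite -rmorphM -phiA -rmorphB def_c addrC addKr.
have := congr1 (fun p : {poly K} => size p) def_phi.
rewrite /= size_mul // => def_size.
have := leq_trans (size_polyD (phi c) (- k%:P)) (leqnn _).
rewrite -def_size size_polyN; have := size_polyC_leq1 k.
move: lt_n z_gt1 nz_phi_y; rewrite -size_poly_gt0.
move: (size (phi c)) (size (phi y)) (size (phi z)) (size k%:P) => a b c' d; lia.
Qed.

Lemma cent_horner_inj (z : C) : (1 < size (phi z))%N -> injective (horner_alg z).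
Proof.
move=> z_gt1 p q /eqP; rewrite -subr_eq0 -rmorphB => /eqP pq0.
apply/eqP; rewrite -subr_eq0 -(comp_poly_eq0 _ z_gt1).
suff -> : (p - q) \Po phi z = phi (horner_alg z (p - q)) by rewrite pq0 rmorph0.
move: (p - q); elim/poly_ind => [|r k IHr]; first by rewrite comp_poly0 !rmorph0.
rewrite comp_poly_MXaddC IHr !rmorphD !rmorphM /= horner_algX horner_algC.
by rewrite phiA.
Qed.

Lemma cent_isomorphic : alg_isomorphic C {poly K}.
Proof.
have [z z_gt1 gen] := cent_generator.
have surj (c : C) : exists p : {poly K}, horner_alg z p == c.
  by have [p <-] := cent_poly z_gt1 gen c; exists p.
pose psi (c : C) : {poly K} := xchoose (surj c).
have psiK : cancel psi (horner_alg z) by move=> c; apply/eqP/(xchooseP (surj c)).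
have psiK' : cancel (horner_alg z) psi.
  by move=> p; apply: (cent_horner_inj z_gt1); rewrite psiK.
pose zM := GRing.isZmodMorphism.Build C {poly K} psi (can2_zmod_morphism psiK' psiK).
pose mM := GRing.isMonoidMorphism.Build C {poly K} psi (can2_monoid_morphism psiK' psiK).
have psiZ : scalable psi.
  by move=> k c; apply: (cent_horner_inj z_gt1); rewrite psiK linearZ /= psiK -scalerAl mul1r.
pose sM := GRing.isScalable.Build K C {poly K} *:%R psi psiZ.
pose psiR : {lrmorphism C -> {poly K}} := HB.pack psi zM mM sM.
by exists psiR; exists (horner_alg z).
Qed.

End Centralizer.

(** * The free algebra *)

Section Instance.
Variables (K : fieldType) (X : choiceType).
Local Notation A := (free_alg K X).
Implicit Types (g h : A) (u v w : seq X).

Definition fcoef w g : K := g@_(FMonom w).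

Definition fsupp g : seq (seq X) := [seq val k | k <- msupp g].

(** The coefficients of g on the words ending in b, with that suffix removed. The
    domain also contains truncations of words that do not end in b; there the
    value is the coefficient of g on the word extended by b, as it should be. *)
Definition fshift (b : seq X) g : A :=
  [malg k in [fset FMonom (take (size (k : fmonom X) - size b) k) | k in msupp g]%fset =>
     g@_(FMonom (k ++ b))].

Lemma fcoef_shift b w g : fcoef w (fshift b g) = fcoef (w ++ b) g.
Proof.
rewrite /fcoef mcoeffE; case: ifPn => // w_out.
rewrite mcoeff_outdom //; apply: contra w_out => w_in.
apply/imfsetP; exists (FMonom (w ++ b)) => //=.
by rewrite size_cat addnK take_size_cat.
Qed.

Lemma fcoefB w : zmod_morphism (fcoef w).
Proof. by move=> g h; rewrite /fcoef mcoeffB. Qed.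

Lemma fcoefZ w c g : fcoef w (c *: g) = c * fcoef w g.
Proof. exact: mcoeffZ. Qed.

Lemma fcoef1 w : fcoef w 1 = (w == [::])%:R.
Proof. by rewrite /fcoef mcoeff1 -val_eqE /= fm1. Qed.

Lemma fsupp_uniq g : uniq (fsupp g).
Proof. by rewrite map_inj_uniq ?fset_uniq //; apply: val_inj. Qed.

Lemma fcoefM_supp w g h : fcoef w (g * h) =
  \sum_(u <- fsupp g) \sum_(v <- fsupp h) (fcoef u g * fcoef v h) *+ (u ++ v == w).
Proof.
rewrite /fcoef mcoeffMl big_map; apply: eq_bigr => -[u] _.
rewrite big_map; apply: eq_bigr => -[v] _.
by rewrite -val_eqE /= fmM.
Qed.

Lemma fcoef_out w g : w \notin fsupp g -> fcoef w g = 0.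
Proof.
move=> w_out; apply: mcoeff_outdom; apply: contra w_out => w_in.
by apply/mapP; exists (FMonom w).
Qed.

Lemma fcoefP g : (forall w, fcoef w g = 0) -> g = 0.
Proof. by move=> g0; apply/malgP => -[w]; rewrite mcoeff0; apply: g0. Qed.

Definition free_word_basis : word_basis X A :=
  WordBasis fcoefB fcoefZ fcoef1 fsupp_uniq fcoefM_supp fcoef_out fcoefP fcoef_shift.

End Instance.

Lemma centralizer_isomorphic (K : fieldType) (X : choiceType) (R : algType K)
    (B : word_basis X R) (f : R) :
  ~ wscalar B f -> alg_isomorphic (centralizer f) {poly K}.
Proof.
move=> nsc_f; have [Phi [PhiB PhiZ Phi1 PhiM Phi_inj]] := centralizer_embedding nsc_f.
have Cf (x : centralizer f) : f * val x = val x * f.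
  by apply/esym/centralizerP/valP.
pose phi (x : centralizer f) := Phi (val x).
have phiB : zmod_morphism phi by move=> x y; apply: PhiB.
have phiM : monoid_morphism phi.
  by split=> [|x y]; [exact: Phi1 | apply: PhiM; apply: Cf].
pose zM := GRing.isZmodMorphism.Build _ {poly K} phi phiB.
pose mM := GRing.isMonoidMorphism.Build _ {poly K} phi phiM.
pose phiR : {rmorphism centralizer f -> {poly K}} := HB.pack phi zM mM.
apply: (@cent_isomorphic _ _ _ B f nsc_f phiR).
  move=> x y /eqP; rewrite -subr_eq0 -rmorphB => /eqP/(Phi_inj _ (Cf (x - y))) xy0.
  by apply/eqP; rewrite -subr_eq0 -val_eqE; apply/eqP.
by move=> c; rewrite /= /phi PhiZ Phi1 -mul_polyC mulr1.
Qed.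

Theorem mainTheorem1 (K : fieldType) (X : choiceType) (f : free_alg K X)
    (hf : ~ exists c : K, f = c%:A) :
  alg_isomorphic (centralizer f) {poly K}.
Proof.
apply: (centralizer_isomorphic (B := free_word_basis K X)) => sc_f.
by apply: hf; exists (fcoef [::] f).
Qed.
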